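(* For any positive $k$ and $d$ large enough such that $k\ll d$ with $k\le d/4$, there exists a ReLU generative network $G:\mathbb R^{k+1}\to\mathbb R^d$ (without offsets), with a $(k+1)$-dimensional input and depth $n=3$, such that for the linear model before quantization $\check y=\langle a,\theta_0\rangle+\xi$, where $\theta_0\in G(\mathbb R^{k+1})\cap\mathbb B_2^d(1)$, $\xi\sim\mathcal N(0,1)$, $a\sim\mathcal N(0,\mathbf I_d)$ and $m\ge c_1k\log(d/k)$, we have $$\inf_{\widehat\theta}\ \sup_{\theta_0\in G(\mathbb R^{k+1})\cap\mathbb B_2^d(1)}\mathbb E\|\widehat\theta-\theta_0\|_2\ \ge\ c_2\sqrt{\frac{k\log(d/k)}{m}},$$ where $c_1,c_2>0$ are absolute constants and the infimum is taken over all estimators $\widehat\theta$ generated by all possible algorithms depending only on $m$ i.i.d. copies of $(a,\check y)$.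
   Context: A ReLU network of depth $n=3$ (without offsets) is a map of the form $G(x)=\sigma\circ(W_3\,\sigma\circ(W_2\,\sigma\circ(W_1x)))$, where $\sigma(t)=\max\{t,0\}$ is applied entrywise and $W_i\in\mathbb R^{d_i\times d_{i-1}}$ with $d_0=k+1$, $d_3=d$ and $d_i\le d$ for $i=1,2,3$. $\mathbb B_2^d(1)$ is the Euclidean unit ball of $\mathbb R^d$ centered at the origin. *)

(* Defs.v *)
From HB Require Import structures.
From mathcomp Require Import all_boot all_order all_algebra.
From mathcomp Require Import all_classical all_reals all_analysis.
From mathcomp Require Import measurable_realfun.

Set Implicit Arguments.
Unset Strict Implicit.
Unset Printing Implicit Defensive.

Import Order.TTheory GRing.Theory Num.Theory.

Local Open Scope classical_set_scope.
Local Open Scope ring_scope.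

(* The norm of the library on matrices is the maximum norm, hence a separate
   Euclidean norm. *)
Definition l2norm (R : realType) (d : nat) (v : 'cV[R]_d) : R :=
  Num.sqrt (\sum_(i < d) v i ord0 ^+ 2).

Definition unit_ball (R : realType) (d : nat) : set 'cV[R]_d :=
  [set v | l2norm v <= 1].

Arguments unit_ball : clear implicits.

Definition relu (R : realType) (p : nat) (v : 'cV[R]_p) : 'cV[R]_p :=
  map_mx (fun t => Num.max t 0) v.

Definition relu_network3 (R : realType) (d0 d1 d2 d3 : nat)
    (W1 : 'M[R]_(d1, d0)) (W2 : 'M[R]_(d2, d1)) (W3 : 'M[R]_(d3, d2))
    (x : 'cV[R]_d0) : 'cV[R]_d3 :=
  relu (W3 *m relu (W2 *m relu (W1 *m x))).

Definition is_relu_network3 (R : realType) (d0 d : nat)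
    (G : 'cV[R]_d0 -> 'cV[R]_d) : Prop :=
  exists (d1 d2 : nat) (W1 : 'M[R]_(d1, d0)) (W2 : 'M[R]_(d2, d1))
    (W3 : 'M[R]_(d, d2)),
    [/\ (d1 <= d)%N, (d2 <= d)%N & G = relu_network3 W1 W2 W3].

Section iid.
Context d (T : measurableType d) (R : realType).

Definition tuple_cons (n : nat) (x : T * n.-tuple T) : n.+1.-tuple T :=
  [the n.+1.-tuple T of x.1 :: x.2].

Lemma measurable_tuple_cons (n : nat) :
  measurable_fun [set: T * n.-tuple T] (@tuple_cons n).
Proof. exact: measurable_cons. Qed.

HB.instance Definition _ (n : nat) :=
  isMeasurableFun.Build _ _ _ _ (@tuple_cons n) (@measurable_tuple_cons n).

(* The n-fold product measure: the joint law of n independent random variables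
   with law P. *)
Fixpoint iid_prob (P : probability T R) (n : nat) :
    probability (n.-tuple T) R :=
  match n with
  | 0 => \d_ [tuple]
  | n'.+1 => distribution (P \x iid_prob P n')%E (@tuple_cons n')
  end.

End iid.

Section standard_normal.
Context (R : realType).

(* normal_prob lives on measurableTypeR R, which has the same measurable sets as
   R but another display; the identity moves it to R. *)
Definition borel_id (x : measurableTypeR R) : R := x.

Lemma measurable_borel_id : measurable_fun setT borel_id.
Proof. exact: measurable_id. Qed.

HB.instance Definition _ :=
  isMeasurableFun.Build _ _ _ _ borel_id measurable_borel_id.

Definition std_normal : probability R R :=
  distribution (normal_prob (0 : R) 1) borel_id.

End standard_normal.

Section linear_model.
Context (R : realType) (d : nat).
Implicit Types theta : 'cV[R]_d.

Definition gaussian_vector : probability (d.-tuple R) R :=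
  iid_prob (std_normal R) d.

Definition observe theta (w : d.-tuple R * R) : d.-tuple R * R :=
  (w.1, \sum_(i < d) tnth w.1 i * theta i ord0 + w.2).

Lemma measurable_observe theta : measurable_fun setT (observe theta).
Proof.
apply: measurable_fun_pair; first exact: measurable_fst.
apply: (@measurable_funD _ _ _ _
  (fun w : d.-tuple R * R => \sum_(i < d) tnth w.1 i * theta i ord0) snd).
  apply: (@measurable_sum _ _ _ _ _ _
    (fun i (w : d.-tuple R * R) => tnth w.1 i * theta i ord0)) => i.
  apply: (@measurable_funM _ _ _ _
    (fun w : d.-tuple R * R => tnth w.1 i) (cst (theta i ord0))).
    exact: (@measurableT_comp _ _ _ _ _ _ (fun a : d.-tuple R => tnth a i) _
      fst (measurable_tnth i)).
  exact: measurable_cst.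
exact: measurable_snd.
Qed.

HB.instance Definition _ theta :=
  isMeasurableFun.Build _ _ _ _ (observe theta) (measurable_observe theta).

(* The law of (a, <a, theta> + xi) with a ~ N(0, I_d) and xi ~ N(0, 1)
   independent. *)
Definition sample_law theta : probability (d.-tuple R * R)%type R :=
  distribution (gaussian_vector \x std_normal R)%E (observe theta).

Definition data_law (m : nat) theta :
    probability (m.-tuple (d.-tuple R * R)) R :=
  iid_prob (sample_law theta) m.

(* Coordinatewise measurability is Borel measurability into R^d. *)
Definition estimators (m : nat) : set (m.-tuple (d.-tuple R * R) -> 'cV[R]_d) :=
  [set est | forall i : 'I_d, measurable_fun setT (fun z => est z i ord0)].

Definition risk (m : nat) (est : m.-tuple (d.-tuple R * R) -> 'cV[R]_d)
    theta : \bar R :=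
  'E_(data_law m theta)[fun z => l2norm (est z - theta)]%E.

Definition minimax_risk (m : nat) (K : set 'cV[R]_d) : \bar R :=
  ereal_inf [set ereal_sup [set risk est theta | theta in K]
            | est in @estimators m].

End linear_model.

(* Main.v *)
From HB Require Import structures.
Require Import Defs.
From mathcomp Require Import all_boot all_order all_algebra.
From mathcomp Require Import all_classical all_reals all_analysis.
From mathcomp Require Import measurable_realfun.
From mathcomp Require Import ring lra.

(* The network produces k-sparse vectors with one entry r in each of k bins of
   about d/k coordinates: in bin i a tent function, built from hinges
   max(x_i - t z, 0) with t a natural number, selects a coordinate, and the
   extra input z plays the part of the missing offset and sets the scale r.
   There are at least (d/k)^{ck} such codewords and their norm is r sqrt k.

   The lower bound is of Assouad type, with an n-ary test in each bin.  For a
   codeword theta and a bin i, compare the data law of theta with that of theta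
   with bin i erased: the second moment of the likelihood ratio of m samples is
   at most exp(2 m r^2), because E exp(r^2 a^2) = (1 - 2 r^2)^{-1/2} for a
   standard normal a.  The reference law does not depend on the label in bin i,
   so averaged over that label it gives the success event a probability at most
   the inverse of the number n of labels; by Cauchy-Schwarz the average success
   probability stays bounded away from 1 as long as exp(2 m r^2) <= 3 n / 4,
   which holds for r^2 = log(d/k) / (16 m).  An estimator thus errs on average
   in at least k/10 bins, each of which costs r/2. *)

Set Implicit Arguments.
Unset Strict Implicit.
Unset Printing Implicit Defensive.

Import Order.TTheory GRing.Theory Num.Theory.
Local Open Scope classical_set_scope.
Local Open Scope ring_scope.

(** * Chi-square domination *)

Section chi_square_domination.
Local Open Scope ereal_scope.

Lemma two_mule_le (R : realType) (x : \bar R) (v t : R) :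
  0 <= x -> (0 < t)%R ->
  2%:E * (x * v%:E) <= t%:E * (x * x) + (v ^+ 2 / t)%:E.
Proof.
move=> x0 t0; case: x x0 => [x||] //; rewrite ?lee_fin => x0.
- rewrite -subr_ge0.
  have -> : (t * (x * x) + v ^+ 2 / t - 2 * (x * v) = (t * x - v) ^+ 2 / t)%R.
    by field; rewrite gt_eqF.
  by rewrite divr_ge0 ?sqr_ge0// ltW.
- by rewrite mulyy gt0_muley ?lte_fin// addye// leey.
Qed.

Lemma cauchy_schwarz_integral d (T : measurableType d) (R : realType)
    (mu : {measure set T -> \bar R}) (u : T -> \bar R) (v : T -> R) (B : R) :
  measurable_fun setT u -> (forall x, 0 <= u x) ->
  measurable_fun setT v -> (forall x, 0 <= v x)%R -> (0 < B)%R ->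
  \int[mu]_x ((v x) ^+ 2)%:E <= B%:E ->
  (\int[mu]_x (u x * (v x)%:E)) * (\int[mu]_x (u x * (v x)%:E)) <=
  B%:E * \int[mu]_x (u x * u x).
Proof.
move=> meas_u u0 mv v0 B0 vB.
set I := \int[mu]_x (u x * (v x)%:E); set J := \int[mu]_x (u x * u x).
have I0 : 0 <= I by apply: integral_ge0 => x _; rewrite mule_ge0// lee_fin.
have J0 : 0 <= J by apply: integral_ge0 => x _; rewrite mule_ge0.
have muv : measurable_fun setT (fun x => u x * (v x)%:E).
  by apply: emeasurable_funM => //; exact/measurable_EFinP.
have muu : measurable_fun setT (fun x => u x * u x) by exact: emeasurable_funM.
have mv2 : measurable_fun setT (fun x => (v x ^+ 2)%:E).
  by apply/measurable_EFinP; exact: measurable_funX.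
have key (t : R) : (0 < t)%R -> 2%:E * I <= t%:E * J + (B / t)%:E.
  move=> t0.
  have -> : 2%:E * I = \int[mu]_x (2%:E * (u x * (v x)%:E)).
    by rewrite ge0_integralZl// => x _; rewrite mule_ge0// lee_fin.
  apply: (@le_trans _ _ (\int[mu]_x (t%:E * (u x * u x) + (v x ^+ 2 / t)%:E))).
    apply: ge0_le_integral => //.
    - by move=> x _; rewrite mule_ge0// mule_ge0// lee_fin.
    - exact: measurable_funeM.
    - apply: emeasurable_funD; first exact: measurable_funeM.
      apply/measurable_EFinP; apply: measurable_funM => //.
      exact: measurable_funX.
    - by move=> x _; exact: two_mule_le.
  rewrite ge0_integralD//; last 4 first.
  - by move=> x _; rewrite mule_ge0 ?mule_ge0// lee_fin ltW.
  - exact: measurable_funeM.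
  - by move=> x _; rewrite lee_fin divr_ge0 ?sqr_ge0// ltW.
  - apply/measurable_EFinP; apply: measurable_funM => //.
    exact: measurable_funX.
  rewrite ge0_integralZl//; last 2 first.
  - by move=> x _; rewrite mule_ge0.
  - by rewrite lee_fin ltW.
  rewrite leeD2l//; under eq_integral do rewrite EFinM.
  rewrite ge0_integralZr//.
  - by rewrite EFinM lee_wpmul2r// lee_fin invr_ge0 ltW.
  - by move=> x _; rewrite lee_fin sqr_ge0.
  - by rewrite lee_fin invr_ge0 ltW.
have [Jy|Jfin] := eqVneq J +oo; first by rewrite Jy gt0_muley ?lte_fin// leey.
have {}Jfin : J \is a fin_num by rewrite ge0_fin_numE// ltey.
have Ifin : I \is a fin_num.
  rewrite ge0_fin_numE//; have := key 1%R ltr01.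
  case: (I) I0 => [i| |] // _; first by rewrite ltry.
  by rewrite gt0_muley ?lte_fin// mul1e -(fineK Jfin) -EFinD leye_eq.
move: key I0 J0; rewrite -(fineK Ifin) -(fineK Jfin).
move: (fine I) (fine J) => i j key; rewrite !lee_fin => i0 j0.
have [->|in0] := eqVneq i 0%R; first by rewrite mul0r mulr_ge0// ltW.
have ip : (0 < i)%R by rewrite lt_neqAle eq_sym in0.
have := key (B / i)%R (divr_gt0 B0 ip).
rewrite -!EFinM -EFinD lee_fin invf_div mulrCA divff ?gt_eqF// mulr1 => h.
have : (i <= B * j / i)%R by rewrite mulrAC; lra.
by rewrite ler_pdivlMr.
Qed.

(* [chi2_dom B P Q] bounds the chi-square affinity of P and Q by B: when P << Q
   it says that the Q-integral of (dP/dQ)^2 is at most B.  The test-function form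
   needs no density and passes to products and images. *)
Definition chi2_dom d (T : measurableType d) (R : realType) (B : R)
    (P Q : {measure set T -> \bar R}) :=
  forall u : T -> \bar R, measurable_fun setT u -> (forall x, 0 <= u x) ->
  (\int[P]_x u x) * (\int[P]_x u x) <= B%:E * \int[Q]_x (u x * u x).

Lemma chi2_dom_distribution d d' (T : measurableType d) (T' : measurableType d')
    (R : realType) (B : R) (P Q : probability T R) (X : {mfun T >-> T'}) :
  chi2_dom B P Q -> chi2_dom B (distribution P X) (distribution Q X).
Proof.
move=> h u mu u0.
rewrite (@ge0_integral_distribution _ _ _ _ _ P X u)//.
rewrite (@ge0_integral_distribution _ _ _ _ _ Q X (fun x => u x * u x))//.
- by apply: (h (u \o X)) => [|x]; [exact: measurableT_comp|exact: u0].
- exact: emeasurable_funM.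
- by move=> y; rewrite mule_ge0.
Qed.

Lemma chi2_dom_prod d d' (T : measurableType d) (T' : measurableType d')
    (R : realType) (B B' : R) (P Q : probability T R) (P' Q' : probability T' R) :
  (0 <= B)%R -> (0 <= B')%R ->
  chi2_dom B P Q -> chi2_dom B' P' Q' ->
  chi2_dom (B * B')%R (P \x P')%E (Q \x Q')%E.
Proof.
move=> B0 B'0 h h' u mu u0.
have muu : measurable_fun setT (fun x => u x * u x) by exact: emeasurable_funM.
have uu0 x : 0 <= u x * u x by rewrite mule_ge0.
rewrite (fubini_tonelli1 u)// (fubini_tonelli1 (fun x => u x * u x))//.
have mF := measurable_fun_fubini_tonelli_F (m2 := P') u mu u0.
have mG := measurable_fun_fubini_tonelli_F (m2 := Q') _ muu uu0.
apply: (le_trans (h _ mF _)).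
  by move=> x; apply: integral_ge0.
rewrite EFinM -muleA lee_wpmul2l ?lee_fin// -ge0_integralZl//; last first.
  by move=> x _; apply: integral_ge0.
apply: ge0_le_integral => //.
- by move=> x _; rewrite mule_ge0//; apply: integral_ge0.
- exact: emeasurable_funM.
- exact: measurable_funeM.
- move=> x _; apply: (h' (fun y => u (x, y))) => //.
  by apply: measurableT_comp => //; exact: measurable_pair1.
Qed.

Lemma chi2_dom_iid d (T : measurableType d) (R : realType) (B : R)
    (P Q : probability T R) (n : nat) :
  (0 <= B)%R -> chi2_dom B P Q ->
  chi2_dom (B ^+ n)%R (iid_prob P n) (iid_prob Q n).
Proof.
move=> B0 h; elim: n => [|n IH].
  by move=> u mu u0; rewrite /= !integral_dirac// ?diracT ?mul1e//;
     exact: emeasurable_funM.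
rewrite exprS /=; apply: chi2_dom_distribution.
by apply: chi2_dom_prod => //; exact: exprn_ge0.
Qed.

Lemma integral_iid_tnth d (T : measurableType d) (R : realType)
    (P : probability T R) (n : nat) (i : 'I_n) (F : T -> \bar R) :
  measurable_fun setT F -> (forall x, 0 <= F x) ->
  \int[iid_prob P n]_w F (tnth w i) = \int[P]_x F x.
Proof.
move=> mF F0; elim: n i => [[]//|n IH] i /=.
have mt m (j : 'I_m) : measurable_fun setT (fun w : m.-tuple T => F (tnth w j)).
  by apply: measurableT_comp => //; exact: measurable_tnth.
rewrite (@ge0_integral_distribution _ _ _ _ _ _ _
  (fun w : n.+1.-tuple T => F (tnth w i)) (mt _ i))//=.
case: (unliftP ord0 i) => [j ->|->].
- rewrite (@eq_integral _ _ _ _ _ (fun x => F (tnth x.2 j))); last first.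
    by move=> x _ /=; rewrite tnthS.
  rewrite (fubini_tonelli1 (fun x : T * n.-tuple T => F (tnth x.2 j)))//.
    rewrite /fubini_F /=.
    under eq_integral do rewrite IH.
    by rewrite integral_cst//= probability_setT mule1.
  exact: (measurableT_comp (mt _ j)).
- rewrite (@eq_integral _ _ _ _ _ (fun x => F x.1)); last first.
    by move=> x _ /=; rewrite tnth0.
  rewrite (fubini_tonelli1 (fun x : T * n.-tuple T => F x.1))//.
    rewrite /fubini_F /=.
    by under eq_integral do rewrite integral_cst//= probability_setT mule1.
  exact: measurableT_comp.
Qed.

End chi_square_domination.

(** * One-dimensional Gaussian integrals *)

Section gaussian.
Context (R : realType).
Local Open Scope ereal_scope.
Local Notation mu := (@lebesgue_measure R).

Lemma integral_lebesgue_shift (f : measurableTypeR R -> \bar R) (c : R) :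
  measurable_fun setT f -> (forall x, 0 <= f x) ->
  \int[mu]_x f (x + c)%R = \int[mu]_x f x.
Proof.
move=> mf f0.
pose s : measurableTypeR R -> measurableTypeR R := fun x => (x + c)%R.
have ms : measurable_fun setT s.
  by apply: (@measurable_funD _ (measurableTypeR R) R setT id (cst c)).
pose sm : {mfun measurableTypeR R >-> measurableTypeR R} :=
  HB.pack s (isMeasurableFun.Build _ _ _ _ s ms).
have e : forall A, measurable A -> mu A = pushforward mu sm A.
  apply: lebesgue_measure_unique => X [[a b] _ <-] /=.
  rewrite /pushforward (_ : s @^-1` _ = `](a - c)%R, (b - c)%R]%classic).
    rewrite !lebesgue_measure_itv /= !lte_fin ltrD2r.
    by case: ifPn => // _; rewrite -!EFinB; congr EFin; ring.
  apply/seteqP; split => x /=; rewrite !in_itv /= /s => /andP[h1 h2];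
    apply/andP; split; lra.
transitivity (\int[pushforward mu sm]_x f x).
  by rewrite ge0_integral_pushforward//.
by apply: eq_measure_integral => A mA _; apply: esym; exact: e.
Qed.

Lemma integral_std_normal (f : R -> \bar R) :
  measurable_fun setT f -> (forall x, 0 <= f x) ->
  \int[std_normal R]_x f x = \int[mu]_x (f x * (normal_pdf 0 1 x)%:E).
Proof.
move=> mf f0.
have dom := @normal_prob_dominates R 0 1.
have mpdf : measurable_fun setT (fun x : measurableTypeR R => (normal_pdf 0 1 x)%:E).
  by apply/measurable_EFinP; exact: measurable_normal_pdf.
have mfb : measurable_fun setT (fun x : measurableTypeR R => f (borel_id x)).
  exact: measurableT_comp.
rewrite /std_normal (@ge0_integral_distribution _ _ _ _ _ _ (@borel_id R))//=.
rewrite -(Radon_Nikodym_SigmaFinite.change_of_variables dom)//.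
apply: ae_eq_integral => //.
- by apply: emeasurable_funM => //;
     exact: measurable_int (Radon_Nikodym_SigmaFinite.f_integrable dom).
- exact: emeasurable_funM.
- apply: ae_eqe_mul2l; apply: integral_ae_eq => //.
  + exact: Radon_Nikodym_SigmaFinite.f_integrable.
  + by move=> E _ mE; rewrite -(Radon_Nikodym_SigmaFinite.f_integral dom).
Qed.

Lemma normal_pdf01 (x : R) :
  normal_pdf 0 1 x = (normal_peak 1 * expR (- x ^+ 2 / 2))%R.
Proof. by rewrite normal_pdfE// /normal_fun subr0 expr1n. Qed.

Lemma integral_std_normal_shift (f : R -> \bar R) (c : R) :
  measurable_fun setT f -> (forall x, 0 <= f x) ->
  \int[std_normal R]_x f (x + c)%R =
  \int[std_normal R]_x (f x * (expR (c * x - c ^+ 2 / 2))%:E).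
Proof.
move=> mf f0.
have mfc : measurable_fun setT (fun x : R => f (x + c)%R).
  by apply: measurableT_comp => //; exact: measurable_funD.
have me : measurable_fun setT (fun x : R => (expR (c * x - c ^+ 2 / 2))%:E).
  apply/measurable_EFinP; apply: measurableT_comp => //.
  apply: measurable_funB => //; exact: measurable_funM.
rewrite integral_std_normal// integral_std_normal//; last 2 first.
- exact: emeasurable_funM.
- by move=> x; rewrite mule_ge0// lee_fin expR_ge0.
rewrite -[RHS](@integral_lebesgue_shift _ c); last 2 first.
- apply: emeasurable_funM; first exact: emeasurable_funM.
  by apply/measurable_EFinP; exact: measurable_normal_pdf.
- by move=> x; rewrite !mule_ge0// lee_fin ?expR_ge0// normal_pdf_ge0.
apply: eq_integral => x _; rewrite -muleA -EFinM; congr (_ * _%:E).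
rewrite !normal_pdf01 mulrCA -expRD; congr (_ * expR _)%R.
by field.
Qed.

Lemma integral_std_normal_expR (c : R) :
  \int[std_normal R]_x (expR (c * x - c ^+ 2 / 2))%:E = 1.
Proof.
transitivity (\int[std_normal R]_x (cst (1 : \bar R) (x + c)%R)).
  rewrite integral_std_normal_shift//.
  by apply: eq_integral => x _; rewrite mul1e.
by rewrite /= integral_cst//= probability_setT mule1.
Qed.

Lemma integral_std_normal_expR_sqr (s : R) : (s < 2^-1)%R ->
  \int[std_normal R]_x (expR (s * x ^+ 2))%:E =
  ((Num.sqrt (1 - 2 * s))^-1)%:E.
Proof.
move=> s12; set t : R := Num.sqrt _.
have s0 : (0 < 1 - 2 * s)%R by lra.
have t0 : (0 < t)%R by rewrite sqrtr_gt0.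
have t2 : (t ^+ 2 = 1 - 2 * s)%R by rewrite sqr_sqrtr// ltW.
have tn : (t^-1 != 0)%R by rewrite invr_eq0 gt_eqF.
rewrite integral_std_normal; last 2 first.
- apply/measurable_EFinP; apply: measurableT_comp => //.
  by apply: measurable_funM => //; exact: measurable_funX.
- by move=> x; rewrite lee_fin expR_ge0.
transitivity (\int[mu]_x ((t^-1)%R%:E * (normal_pdf 0 t^-1%R x)%:E)).
  apply: eq_integral => x _; rewrite -!EFinM; congr EFin.
  rewrite normal_pdf01 normal_pdfE// mulrCA -expRD [RHS]mulrA; congr (_ * _)%R.
    rewrite /normal_peak -!mulrnAr !(sqrtrM _ (sqr_ge0 _)) !sqrtr_sqr normr1 mul1r.
    rewrite ger0_norm ?invr_ge0 ?ltW// invfM invrK mulrA mulVf ?mul1r//.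
    by rewrite gt_eqF.
  rewrite /normal_fun subr0; congr expR.
  rewrite exprVn t2 -[X in (_ / X)%R]mulr_natr; field.
  by rewrite gt_eqF//= -t2 expf_neq0// gt_eqF.
rewrite ge0_integralZl//.
- by rewrite integral_normal_pdf mule1.
- by apply/measurable_EFinP; exact: measurable_normal_pdf.
- by move=> x _; rewrite lee_fin normal_pdf_ge0.
- by rewrite lee_fin invr_ge0 ltW.
Qed.

Lemma chi2_dom_std_normal_shift (c : R) (u : R -> \bar R) :
  measurable_fun setT u -> (forall x, 0 <= u x) ->
  (\int[std_normal R]_x u (x + c)%R) * (\int[std_normal R]_x u (x + c)%R) <=
  (expR (c ^+ 2))%:E * \int[std_normal R]_x (u x * u x).
Proof.
move=> meas_u u0; rewrite integral_std_normal_shift//.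
apply: cauchy_schwarz_integral => //.
- by apply: measurableT_comp => //; exact: measurable_funB.
- exact: expR_gt0.
rewrite (@eq_integral _ _ _ _ _ (fun x => (expR (c ^+ 2))%:E *
    (expR ((2 * c) * x - (2 * c) ^+ 2 / 2))%:E)); last first.
  move=> x _; rewrite -EFinM -expRM_natl -expRD; congr (expR _)%:E.
  by field.
rewrite ge0_integralZl//.
- by rewrite integral_std_normal_expR mule1.
- apply/measurable_EFinP; apply: measurableT_comp => //.
  by apply: measurable_funB => //; exact: measurable_funM.
Qed.

End gaussian.

Section linear_model.
Context (R : realType) (d : nat).
Local Open Scope ereal_scope.
Implicit Types theta : 'cV[R]_d.

Let inner theta (a : d.-tuple R) : R := (\sum_(i < d) tnth a i * theta i ord0)%R.

Let measurable_inner theta : measurable_fun setT (inner theta).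
Proof.
apply: (@measurable_sum _ _ _ _ _ _
  (fun i (a : d.-tuple R) => (tnth a i * theta i ord0)%R)) => i.
apply: (@measurable_funM _ _ _ _ (fun a : d.-tuple R => tnth a i)
  (cst (theta i ord0))) => //.
exact: measurable_tnth.
Qed.

Let integral_sample_law theta (u : d.-tuple R * R -> \bar R) :
  measurable_fun setT u -> (forall x, 0 <= u x) ->
  \int[sample_law theta]_x u x =
  \int[gaussian_vector R d]_a \int[std_normal R]_e u (a, (inner theta a + e)%R).
Proof.
move=> mu u0.
rewrite (@ge0_integral_distribution _ _ _ _ _ _ (observe theta))//.
rewrite (fubini_tonelli1 (u \o observe theta))//.
- exact: measurableT_comp.
- by move=> x; exact: u0.
Qed.

Lemma chi2_dom_sample_law theta theta' (p : 'I_d) (r : R) :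
  theta = (theta' + r *: delta_mx p ord0)%R -> (r ^+ 2 <= 4^-1)%R ->
  chi2_dom (expR (2 * r ^+ 2)) (sample_law theta) (sample_law theta').
Proof.
move=> thetaE r2 u mu u0.
have muu : measurable_fun setT (fun x => u x * u x) by exact: emeasurable_funM.
have uu0 x : 0 <= u x * u x by rewrite mule_ge0.
rewrite !integral_sample_law//.
have innerE a : (inner theta a = inner theta' a + r * tnth a p)%R.
  rewrite /inner thetaE (eq_bigr (fun i => tnth a i * theta' i ord0 +
    (if i == p then r * tnth a p else 0))%R).
    by rewrite big_split /= -big_mkcond big_pred1_eq.
  move=> i _; rewrite !mxE eqxx andbT mulrDr; congr (_ + _)%R.
  by case: eqP => [->|_]; rewrite ?mulr1 ?mulr0// mulrC.
pose h a := \int[std_normal R]_e u (a, (inner theta a + e)%R).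
pose H a := \int[std_normal R]_e (u (a, (inner theta' a + e)%R) *
  u (a, (inner theta' a + e)%R)).
have mobs th : measurable_fun setT
    (fun w : d.-tuple R * R => u (w.1, (inner th w.1 + w.2)%R)).
  exact: (measurableT_comp mu (measurable_observe th)).
have mh : measurable_fun setT h.
  exact: (measurable_fun_fubini_tonelli_F (m2 := std_normal R) _ (mobs theta)).
have mH : measurable_fun setT H.
  apply: (measurable_fun_fubini_tonelli_F (m2 := std_normal R)
    (fun w : d.-tuple R * R => u (w.1, (inner theta' w.1 + w.2)%R) *
       u (w.1, (inner theta' w.1 + w.2)%R))) => //.
  exact: emeasurable_funM.
have h0 a : 0 <= h a by apply: integral_ge0.
have H0 a : 0 <= H a by apply: integral_ge0.
have hH a : h a * h a <= (expR ((r * tnth a p) ^+ 2))%:E * H a.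
  have mua : measurable_fun setT (fun y => u (a, (inner theta' a + y)%R)).
    apply: measurableT_comp => //; apply: measurable_fun_pair => //.
    exact: measurable_funD.
  have <- : \int[std_normal R]_e
      u (a, (inner theta' a + (e + r * tnth a p))%R) = h a.
    apply: eq_integral => e _; rewrite innerE; congr (u (_, _)); ring.
  exact: (@chi2_dom_std_normal_shift R (r * tnth a p)%R _ mua (fun e => u0 (a, _))).
rewrite -/h -/H.
pose v a := expR (r ^+ 2 / 2 * tnth a p ^+ 2).
pose w a := h a * (expR (- (r ^+ 2 / 2 * tnth a p ^+ 2)))%:E.
have mt : measurable_fun setT (fun a : d.-tuple R => (r ^+ 2 / 2 * tnth a p ^+ 2)%R).
  apply: measurable_funM => //; apply: measurable_funX; exact: measurable_tnth.
have mv : measurable_fun setT v by apply: measurableT_comp.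
have mw : measurable_fun setT w.
  apply: emeasurable_funM => //; apply/measurable_EFinP.
  by apply: measurableT_comp => //; exact: measurable_funN.
have w0 a : 0 <= w a by rewrite mule_ge0// lee_fin expR_ge0.
have hE : \int[gaussian_vector R d]_a h a =
    \int[gaussian_vector R d]_a (w a * (v a)%:E).
  apply: eq_integral => a _.
  by rewrite /w /v -muleA -EFinM -expRD addNr expR0 mule1.
rewrite hE.
apply: (le_trans (cauchy_schwarz_integral (B := expR (2 * r ^+ 2)) mw w0 mv _ _ _)).
- by move=> a; exact: expR_ge0.
- exact: expR_gt0.
- under eq_integral do rewrite /v -expRM_natl mulrA (mulrC 2%R) divfK//.
  rewrite (@integral_iid_tnth _ _ _ (std_normal R) d p
    (fun x => (expR (r ^+ 2 * x ^+ 2))%:E)).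
  + rewrite integral_std_normal_expR_sqr; last by lra.
    rewrite lee_fin -[leRHS]invrK -expRN lef_pV2 ?posrE ?expR_gt0//.
      rewrite -[leLHS](ger0_norm (expR_ge0 _)) -sqrtr_sqr ler_wsqrtr//.
      rewrite -expRM_natl mulrN expRN -[leRHS]invrK.
      rewrite lef_pV2 ?posrE ?expR_gt0 ?invr_gt0//; last by lra.
      apply: (le_trans _ (expR_ge1Dx _)).
      rewrite -[leLHS]mul1r ler_pdivrMr; last by lra.
      by have r20 := sqr_ge0 r; nra.
    by rewrite sqrtr_gt0; lra.
  + apply/measurable_EFinP; apply: measurableT_comp => //.
    by apply: measurable_funM => //; exact: measurable_funX.
  + by move=> x; rewrite lee_fin expR_ge0.
- apply: lee_wpmul2l; first by rewrite lee_fin expR_ge0.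
  apply: ge0_le_integral => //.
  + by move=> a _; rewrite mule_ge0.
  + exact: emeasurable_funM.
  + move=> a _; rewrite /w muleACA -EFinM -expRD.
    apply: (le_trans (lee_wpmul2r _ (hH a))); first by rewrite lee_fin expR_ge0.
    rewrite muleAC -EFinM -expRD (_ : _ + _ = 0)%R ?expR0 ?mul1e//.
    by field.
Qed.

End linear_model.

(** * Averaging over labels *)

Section assouad.
Context d (T : measurableType d) (R : realType).

Lemma chi2_dom_event (P Q : probability T R) (B : R) (A : set T) :
  measurable A -> chi2_dom B P Q ->
  fine (P A) <= 3 / 4 * B * fine (Q A) + 1 / 3.
Proof.
move=> mA /(_ (fun x => (\1_A x)%:E)) h.
have : (P A * P A <= B%:E * Q A)%E.
  have mi : measurable_fun setT (fun x => (\1_A x : R)%:E).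
    exact/measurable_EFinP/measurable_indic.
  have := h mi (fun x => _); rewrite !integral_indic// setIT.
  rewrite (@eq_integral _ _ _ Q _ (fun x => (\1_A x)%:E)); last first.
    move=> x _; rewrite -EFinM indicE.
    by case: (x \in A); rewrite ?mulr1 ?mulr0.
  by rewrite integral_indic// setIT; apply => x; rewrite lee_fin.
have PA : P A \is a fin_num by exact: fin_num_measure.
have QA : Q A \is a fin_num by exact: fin_num_measure.
rewrite -(fineK PA) -(fineK QA) -!EFinM lee_fin /= => {}h.
(* p^2 <= B q gives 2 p <= s B q + 1 / s, taken at s = 3 / 2. *)
by have := sqr_ge0 (fine (P A) - 2 / 3); rewrite expr2; lra.
Qed.

Context (k n : nat) (i : 'I_k).
Local Notation labels := {ffun 'I_k -> 'I_n.+1}.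
Implicit Types l : labels.

Definition label_shift (j : 'I_n.+1) : labels :=
  [ffun i' => if i' == i then j else 0].

Lemma sum_event_le (Q : labels -> probability T R) (A : 'I_n.+1 -> set T) :
  (forall j, measurable (A j)) ->
  trivIset setT A ->
  (forall l j, Q (l + label_shift j) = Q l) ->
  n.+1%:R * \sum_l fine (Q l (A (l i))) <= #|{: labels}|%:R :> R.
Proof.
move=> mA tA Qshift.
have -> : n.+1%:R * \sum_l fine (Q l (A (l i))) =
    \sum_l \sum_j fine (Q l (A j)) :> R.
  transitivity (\sum_(j < n.+1) \sum_l fine (Q l (A (l i)))).
    by rewrite sumr_const card_ord mulr_natl.
  (* Adding j to the label in bin i permutes the labelings and fixes Q. *)
  transitivity (\sum_(j < n.+1) \sum_l fine (Q l (A (l i + j)))).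
    apply: eq_bigr => j _.
    rewrite (reindex_inj (addIr (label_shift j))); apply: eq_bigr => l _.
    by rewrite Qshift !ffunE eqxx.
  rewrite exchange_big; apply: eq_bigr => l _.
  by rewrite [RHS](reindex_inj (addrI (l i))).
rewrite -sum1_card natr_sum; apply: ler_sum => l _.
rewrite -lee_fin -sumEFin.
rewrite (eq_bigr (fun j => Q l (A j))); last first.
  by move=> j _; rewrite fineK//; exact: fin_num_measure.
rewrite -measure_bigsetU_ord//; apply: probability_le1.
by apply: bigsetU_measurable => j _; exact: mA.
Qed.

Lemma sum_success_le (P Q : labels -> probability T R) (A : 'I_n.+1 -> set T)
    (B : R) :
  (forall j, measurable (A j)) ->
  trivIset setT A ->
  (forall l j, Q (l + label_shift j) = Q l) ->
  (forall l, chi2_dom B (P l) (Q l)) ->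
  B <= 3 / 4 * n.+1%:R ->
  \sum_l fine (P l (A (l i))) <= 9 / 10 * #|{: labels}|%:R.
Proof.
move=> mA tA Qshift PQ Bn.
apply: (@le_trans _ _
    (\sum_l (3 / 4 * B * fine (Q l (A (l i))) + 1 / 3))).
  by apply: ler_sum => l _; exact: chi2_dom_event.
rewrite big_split /= -mulr_sumr sumr_const -mulr_natr.
have := sum_event_le mA tA Qshift; set S := \sum_l _.
have S0 : 0 <= S by apply: sumr_ge0 => l _; exact: fine_ge0.
move=> h; have := ler_wpM2r S0 Bn; rewrite -mulrA => h'.
have N0 : 0 <= #|{: labels}|%:R :> R by [].
lra.
Qed.

End assouad.

Section code.
Context (R : realType) (d k n : nat) (pos : 'I_k -> 'I_n.+1 -> 'I_d).
Hypothesis pos_inj : forall i j i' j', pos i j = pos i' j' -> i = i' /\ j = j'.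
Local Notation labels := {ffun 'I_k -> 'I_n.+1}.
Implicit Types (l : labels) (r : R).

Definition bin_code r l : 'cV[R]_d :=
  \sum_i r *: delta_mx (pos i (l i)) ord0.

Definition bin_code_off r (i : 'I_k) l : 'cV[R]_d :=
  \sum_(i' | i' != i) r *: delta_mx (pos i' (l i')) ord0.

Lemma bin_codeD1 r i l :
  bin_code r l = bin_code_off r i l + r *: delta_mx (pos i (l i)) ord0.
Proof. by rewrite /bin_code (bigD1 i)//= addrC. Qed.

Lemma bin_code_off_shift r i l j :
  bin_code_off r i (l + label_shift i j) = bin_code_off r i l.
Proof.
apply: eq_bigr => i' /negPf ii'; do 2!f_equal.
by rewrite !ffunE ii' addr0.
Qed.

Lemma bin_codeE r l p : bin_code r l p ord0 = r * \sum_i (p == pos i (l i))%:R.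
Proof.
rewrite summxE mulr_sumr; apply: eq_bigr => i _.
by rewrite !mxE eqxx andbT.
Qed.

Lemma bin_code_pos r l i j : bin_code r l (pos i j) ord0 = r * (j == l i)%:R.
Proof.
rewrite bin_codeE (bigD1 i)//= big1 ?addr0; last first.
  move=> i' /negPf ii'; case: eqP => // /pos_inj[ii _].
  by rewrite ii eqxx in ii'.
congr (r * _%:R); case: (eqVneq j (l i)) => [->|jl]; first by rewrite eqxx.
by case: eqP => // /pos_inj[_ jl']; rewrite jl' eqxx in jl.
Qed.

Lemma l2norm_bin_code r l : 0 <= r -> l2norm (bin_code r l) = r * Num.sqrt k%:R.
Proof.
move=> r0; rewrite /l2norm.
under eq_bigr do rewrite bin_codeE exprMn.
rewrite -mulr_sumr sqrtrM ?sqr_ge0// sqrtr_sqr ger0_norm//.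
congr (_ * Num.sqrt _).
transitivity (\sum_(p < d) \sum_i ((p == pos i (l i))%:R : R)).
  apply: eq_bigr => p _.
  have [[i pi]|np] := pselect (exists i, p = pos i (l i)).
    rewrite (bigD1 i)//= big1 ?addr0 ?pi ?eqxx ?expr1n//.
    move=> i' /negPf ii'; case: eqP => // /pos_inj[ii _].
    by rewrite ii eqxx in ii'.
  rewrite big1 ?expr0n// => i _; case: eqP => // pi.
  by exfalso; apply: np; exists i.
rewrite exchange_big /= -[k in RHS]card_ord -sum1_card natr_sum.
apply: eq_bigr => i _; rewrite (bigD1 (pos i (l i)))//= eqxx big1 ?addr0//.
by move=> p /negPf ->.
Qed.

Lemma sum_sqr_pos_le (v : 'cV[R]_d) :
  \sum_i \sum_j v (pos i j) ord0 ^+ 2 <= \sum_p v p ord0 ^+ 2.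
Proof.
rewrite pair_big /=.
pose h (q : 'I_k * 'I_n.+1) := pos q.1 q.2.
have hinj : {in predT &, injective h}.
  by move=> [i j] [i' j'] _ _ /pos_inj /= [-> ->].
rewrite -(big_imset (fun p => v p ord0 ^+ 2) hinj).
rewrite [leRHS](bigID (mem (h @: predT)))/= lerDl.
by apply: sumr_ge0 => p _; exact: sqr_ge0.
Qed.

Definition decodes r (v : 'cV[R]_d) i j : bool :=
  [forall j', `|v (pos i j') ord0 - r * (j' == j)%:R| < r / 2].

Lemma decodes_unique r v i j j' : decodes r v i j -> decodes r v i j' -> j = j'.
Proof.
move=> /forallP/(_ j) + /forallP/(_ j); rewrite eqxx.
case: eqVneq => // _ h h'; exfalso.
by move: h h'; rewrite mulr1 mulr0 !ltr_norml => /andP[? ?] /andP[? ?]; lra.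
Qed.

Lemma l2norm_sub_bin_code_ge r l v : (0 < k)%N -> 0 <= r ->
  r / (2 * Num.sqrt k%:R) * \sum_i (~~ decodes r v i (l i))%:R
    <= l2norm (v - bin_code r l).
Proof.
move=> k0 r0; set M := \sum_i _.
have M0 : 0 <= M by apply: sumr_ge0.
have Mk : M <= k%:R.
  rewrite -[k in leRHS]card_ord -sum1_card natr_sum; apply: ler_sum => i _.
  by rewrite ler_nat leq_b1.
have sk : 0 < Num.sqrt k%:R :> R by rewrite sqrtr_gt0 ltr0n.
rewrite -[leLHS]ger0_norm; last first.
  by rewrite mulr_ge0// divr_ge0// mulr_ge0// ltW.
rewrite -sqrtr_sqr ler_wsqrtr//.
apply: le_trans (sum_sqr_pos_le _).
apply: (@le_trans _ _ ((r / 2) ^+ 2 * M)).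
  rewrite invfM mulrA 2!exprMn exprVn sqr_sqrtr// -mulrA ler_wpM2l ?sqr_ge0//.
  by rewrite ler_pdivrMl ?ltr0n// expr2 ler_wpM2r.
rewrite mulr_sumr; apply: ler_sum => i _.
have s0 (P : pred 'I_n.+1) :
    0 <= \sum_(j | P j) (v - bin_code r l) (pos i j) ord0 ^+ 2.
  by apply: sumr_ge0 => j _; exact: sqr_ge0.
case: (boolP (decodes r v i (l i))) => [_|]; first by rewrite mulr0.
rewrite negb_forall mulr1 => /existsP[j]; rewrite -leNgt => h.
rewrite (bigD1 j)//= -[leLHS]addr0 lerD//.
rewrite !mxE bin_code_pos -[leRHS]real_normK ?num_real// ler_sqr ?nnegrE ?divr_ge0//.
Qed.

End code.

(** * The network *)

Section network.
Context (R : realType) (d k n : nat) (pos : 'I_k -> 'I_n.+1 -> 'I_d).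
Local Notation labels := {ffun 'I_k -> 'I_n.+1}.
Local Notation knots := ('I_k * 'I_n.+3)%type.
Local Notation cells := ('I_k * 'I_n.+1)%type.

Definition hinge_layer : 'M[R]_(#|{: knots}|, k.+1) :=
  \matrix_(p, q) let: (i, t) := enum_val p : knots in
    (q == widen_ord (leqnSn k) i)%:R - t%:R * (q == ord_max)%:R.

(* The second difference of the hinges at j, j+1, j+2 is a tent over the knots. *)
Definition tent_layer : 'M[R]_(#|{: cells}|, #|{: knots}|) :=
  \matrix_(p, p') let: (i, j) := enum_val p : cells in
    let: (i', t) := enum_val p' : knots in
    (i' == i)%:R * ((t == j :> nat)%:R - 2 * (t == j.+1 :> nat)%:R
                    + (t == j.+2 :> nat)%:R).

Definition placement_layer : 'M[R]_(d, #|{: cells}|) :=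
  \matrix_(p, q) (p == pos (enum_val q).1 (enum_val q).2)%:R.

Definition bin_network : 'cV[R]_k.+1 -> 'cV[R]_d :=
  relu_network3 hinge_layer tent_layer placement_layer.

Lemma is_relu_network3_bin_network :
  (k * n.+3 <= d)%N -> is_relu_network3 bin_network.
Proof.
move=> kd; exists #|{: knots}|, #|{: cells}|.
exists hinge_layer, tent_layer, placement_layer; split => //.
- by rewrite card_prod !card_ord.
- rewrite card_prod !card_ord (leq_trans _ kd)// leq_mul2l.
  by apply/orP; right; rewrite ltnW.
Qed.

(* The last input coordinate replaces the missing offset: it sets the scale r. *)
Definition code_input (r : R) (l : labels) : 'cV[R]_k.+1 :=
  \col_q (r * (if insub (val q) is Some i then (l i).+1 else 1%N)%:R).

Lemma hinge_layerE r l (i : 'I_k) (t : 'I_n.+3) : 0 <= r ->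
  relu (hinge_layer *m code_input r l) (enum_rank (i, t)) ord0 =
  r * ((l i).+1 - t)%:R.
Proof.
move=> r0; rewrite !mxE.
have -> : \sum_j hinge_layer (enum_rank (i, t)) j * code_input r l j ord0 =
    r * (l i).+1%:R - t%:R * r.
  transitivity (\sum_j ((j == widen_ord (leqnSn k) i)%:R * code_input r l j ord0
     - (j == ord_max)%:R * (t%:R * code_input r l j ord0))).
    by apply: eq_bigr => j _; rewrite mxE enum_rankK; ring.
  rewrite sumrB; congr (_ - _).
    rewrite (bigD1 (widen_ord (leqnSn k) i))//= eqxx mul1r big1 ?addr0.
      rewrite mxE /= (insubT (fun x => x < k)%N (ltn_ord i)) /=.
      by congr (_ * (l _).+1%:R); exact: val_inj.
    by move=> j /negPf ->; rewrite mul0r.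
  rewrite (bigD1 ord_max)//= eqxx mul1r big1 ?addr0.
    by rewrite mxE /= insubF ?ltnn// mulr1.
  by move=> j /negPf ->; rewrite mul0r.
have [ta|at_] := leqP t (l i).+1.
  by rewrite natrB// mulrBr (mulrC t%:R) max_l// -mulrBr -natrB// mulr_ge0.
rewrite (eqP (ltnW at_)) mulr0 max_r// mulrC -mulrBl.
by rewrite mulr_le0_ge0// subr_le0 ler_nat ltnW.
Qed.

Lemma sum_eq_nat (N c : nat) (F : nat -> R) : (c < N)%N ->
  \sum_(t < N) (t == c :> nat)%:R * F t = F c.
Proof.
move=> cN; rewrite (bigD1 (Ordinal cN))//= eqxx mul1r big1 ?addr0// => t.
by rewrite -val_eqE /= => /negPf ->; rewrite mul0r.
Qed.

Lemma tent_layerE r l (i : 'I_k) (j : 'I_n.+1) : 0 <= r ->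
  relu (tent_layer *m relu (hinge_layer *m code_input r l))
    (enum_rank (i, j)) ord0 =
  r * (j == l i)%:R.
Proof.
move=> r0; rewrite !mxE.
pose F (t : nat) : R := ((l i).+1 - t)%:R.
have -> : \sum_p tent_layer (enum_rank (i, j)) p *
      relu (hinge_layer *m code_input r l) p ord0 =
    r * (F j - 2 * F j.+1 + F j.+2).
  pose H (q : knots) := (q.1 == i)%:R * ((q.2 == j :> nat)%:R -
    2 * (q.2 == j.+1 :> nat)%:R + (q.2 == j.+2 :> nat)%:R) *
    (r * ((l q.1).+1 - q.2)%:R).
  transitivity (\sum_(p < #|{: knots}|) H (enum_val p)).
    apply: eq_bigr => p _; rewrite mxE enum_rankK.
    rewrite -[in relu _ p _](enum_valK p) /H; case: (enum_val p) => i' t.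
    by rewrite hinge_layerE.
  rewrite -(big_enum_val H) /= -(pair_bigA _ (fun a b => H (a, b))) /=.
  rewrite (bigD1 i)//= [X in _ + X]big1 ?addr0; last first.
    by move=> i' /negPf ii; rewrite big1// => t _; rewrite /H /= ii !mul0r.
  have j2 : (j.+2 < n.+3)%N by rewrite !ltnS -ltnS.
  have j1 : (j.+1 < n.+3)%N by exact: ltnW.
  have j0 : (j < n.+3)%N by exact: ltnW.
  rewrite -(sum_eq_nat F j0) -(sum_eq_nat F j1) -(sum_eq_nat F j2).
  rewrite mulr_sumr -sumrB -big_split mulr_sumr; apply: eq_bigr => t _ /=.
  by rewrite /H /F /= eqxx mul1r; ring.
have -> : F j - 2 * F j.+1 + F j.+2 = (j == l i)%:R.
  rewrite /F !subSS -val_eqE /=.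
  have [jl|jl|<-] := ltngtP j (l i).
  - by rewrite -[RHS]/(0 : R) subSn ?(ltnW jl)// -(subnSK jl) -!natr1; ring.
  - have /eqP -> : ((l i).+1 - j == 0)%N by rewrite subn_eq0.
    have /eqP -> : (l i - j == 0)%N by rewrite subn_eq0 ltnW.
    have /eqP -> : ((l i) - j.+1 == 0)%N by rewrite subn_eq0 ltnW// ltnW.
    by rewrite -[RHS]/(0 : R); ring.
  - rewrite subSnn subnn (_ : _ - j.+1 = 0)%N ?mulr0 ?subr0 ?addr0//.
    by apply/eqP; rewrite subn_eq0.
by rewrite max_l// mulr_ge0.
Qed.

Lemma code_in_range r l : 0 <= r -> bin_code pos r l = bin_network (code_input r l).
Proof.
move=> r0; apply/colP => p; rewrite bin_codeE [RHS]mxE [in RHS]mxE.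
have -> : \sum_q placement_layer p q * relu (tent_layer *m
      relu (hinge_layer *m code_input r l)) q ord0 =
    r * \sum_i (p == pos i (l i))%:R.
  pose H (q : cells) := (p == pos q.1 q.2)%:R * (r * (q.2 == l q.1)%:R).
  transitivity (\sum_(q < #|{: cells}|) H (enum_val q)).
    apply: eq_bigr => q _; rewrite mxE.
    rewrite -[in relu _ q _](enum_valK q) /H; case: (enum_val q) => i j.
    by rewrite tent_layerE.
  rewrite -(big_enum_val H) /= -(pair_bigA _ (fun a b => H (a, b))) /= mulr_sumr.
  apply: eq_bigr => i _; rewrite (bigD1 (l i))//= big1 ?addr0.
    by rewrite /H /= eqxx mulr1 mulrC.
  by move=> j /negPf jl; rewrite /H /= jl !mulr0.
by rewrite max_l// mulr_ge0// sumr_ge0.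
Qed.

End network.

Section risk.
Context (R : realType) (d k n m : nat) (pos : 'I_k -> 'I_n.+1 -> 'I_d).
Hypothesis pos_inj : forall i j i' j', pos i j = pos i' j' -> i = i' /\ j = j'.
Hypothesis k0 : (0 < k)%N.
Local Notation labels := {ffun 'I_k -> 'I_n.+1}.
Variable est : m.-tuple (d.-tuple R * R) -> 'cV[R]_d.
Hypothesis mest : estimators est.
Implicit Types (l : labels) (r : R).

Let success r i j := [set z | decodes pos r (est z) i j].

Lemma measurable_success r i j : measurable (success r i j).
Proof.
rewrite (_ : success r i j = \big[setI/setT]_(j' < n.+1)
    [set z | `|est z (pos i j') ord0 - r * (j' == j)%:R| < r / 2]).
  apply: bigsetI_measurable => j' _.
  have mf : measurable_fun setT
      (fun z => `|est z (pos i j') ord0 - r * (j' == j)%:R|).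
    by apply: measurableT_comp => //; apply: measurable_funB => //; exact: mest.
  rewrite (_ : [set z | _] = setT `&` (fun z =>
    `|est z (pos i j') ord0 - r * (j' == j)%:R|) @^-1` `]-oo, (r / 2)[%classic).
    exact: mf measurableT _ (measurable_itv _).
  by rewrite setTI; apply/seteqP; split => z /=; rewrite in_itv.
apply/seteqP; split => z.
  move=> /forallP h; elim/big_rec: _ => // j' A _ Az.
  by split => //; exact: h.
move=> h; apply/forallP => j'.
by move: h; rewrite (bigD1 j')//= => -[].
Qed.

Lemma measurable_l2norm_sub (theta : 'cV[R]_d) :
  measurable_fun setT (fun z => l2norm (est z - theta)).
Proof.
apply: (@measurableT_comp _ _ _ _ _ _ (@Num.sqrt R)).
  by apply: continuous_measurable_fun; exact: sqrt_continuous.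
apply: (@measurable_sum _ _ _ _ _ _
  (fun p z => (est z - theta) p ord0 ^+ 2)) => p.
apply: measurable_funX.
rewrite (_ : (fun z => _) = (fun z => est z p ord0 - theta p ord0)).
  by apply: measurable_funB => //; exact: mest.
by apply/funext => z; rewrite !mxE.
Qed.

Lemma risk_bin_code_ge r l : 0 <= r ->
  ((r / (2 * Num.sqrt k%:R) *
     \sum_i (1 - fine (data_law m (bin_code pos r l) (success r i (l i)))))%:E
   <= risk est (bin_code pos r l))%E.
Proof.
move=> r0; rewrite /risk expectation.unlock.
set P := data_law m _; set c := r / _.
have c0 : 0 <= c by rewrite divr_ge0// mulr_ge0.
have mS i : measurable (~` success r i (l i)).
  by apply: measurableC; exact: measurable_success.
apply: (@le_trans _ _
    (\int[P]_z (c * \sum_i \1_(~` success r i (l i)) z)%:E)%E); last first.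
  apply: ge0_le_integral => //.
  - by move=> z _; rewrite lee_fin mulr_ge0// sumr_ge0.
  - apply/measurable_EFinP; apply: measurable_funM => //.
    by apply: measurable_sum => i; exact: measurable_indic.
  - by apply/measurable_EFinP; exact: measurable_l2norm_sub.
  - move=> z _; rewrite lee_fin.
    apply: le_trans (l2norm_sub_bin_code_ge pos_inj l (est z) k0 r0).
    rewrite ler_wpM2l// ler_sum// => i _; rewrite indicE ler_nat.
    by rewrite in_setC mem_setE.
under eq_integral do rewrite EFinM -sumEFin.
rewrite ge0_integralZl//; last 2 first.
- apply: emeasurable_sum => i; apply/measurable_EFinP.
  exact: measurable_indic.
- by move=> z _; rewrite sume_ge0// => i _; rewrite lee_fin.
rewrite ge0_integral_sum//; last first.
  by move=> i; apply/measurable_EFinP; exact: measurable_indic.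
rewrite EFinM lee_wpmul2l ?lee_fin// -sumEFin; apply: lee_sum => i _.
rewrite integral_indic// setIT.
have mSi := measurable_success r i (l i).
rewrite [leRHS](probability_setC P mSi).
by rewrite EFinB fineK//; exact: (fin_num_measure P).
Qed.

Lemma exists_risk_bin_code_ge r : 0 <= r -> r ^+ 2 <= 4^-1 ->
  expR (2 * r ^+ 2) ^+ m <= 3 / 4 * n.+1%:R ->
  exists l, ((r * Num.sqrt k%:R / 20)%:E <= risk est (bin_code pos r l))%E.
Proof.
move=> r0 r2 Bn.
pose s l := \sum_i fine (data_law m (bin_code pos r l) (success r i (l i))).
have [l sl] : exists l, s l <= 9 / 10 * k%:R.
  apply/not_existsP => h.
  have : \sum_l s l <= 9 / 10 * #|{: labels}|%:R * k%:R.
    rewrite exchange_big /= mulr_natr -[X in _ *+ X](card_ord k) -sumr_const.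
    apply: ler_sum => i _.
    apply: (@sum_success_le _ _ _ _ _ i (fun l => data_law m (bin_code pos r l))
      (fun l => data_law m (bin_code_off pos r i l)) (success r i)
      (expR (2 * r ^+ 2) ^+ m)) => //.
    - by move=> j; exact: measurable_success.
    - apply/trivIsetP => j j' _ _ jj'; apply/seteqP; split => // z [/= zj zj'].
      by move: jj'; rewrite (decodes_unique zj zj') eqxx.
    - by move=> l j; rewrite bin_code_off_shift.
    - move=> l; apply: chi2_dom_iid; first exact: expR_ge0.
      by apply: chi2_dom_sample_law r2; exact: bin_codeD1.
  apply/negP; rewrite -ltNge.
  have -> : 9 / 10 * #|{: labels}|%:R * k%:R =
      \sum_(l : labels) (9 / 10 * k%:R) :> R.
    by rewrite sumr_const mulrAC [LHS]mulr_natr.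
  apply: ltr_sum => [|l _]; last by rewrite ltNge; apply/negP; exact: h.
  by apply/hasP; exists [ffun=> ord0]; rewrite ?mem_index_enum.
exists l; apply: le_trans (risk_bin_code_ge _ r0); rewrite lee_fin.
rewrite sumrB sumr_const card_ord -/(s l).
have sk : 0 < Num.sqrt k%:R :> R by rewrite sqrtr_gt0 ltr0n.
have kE : k%:R = Num.sqrt k%:R ^+ 2 :> R by rewrite sqr_sqrtr.
have -> : r * Num.sqrt k%:R / 20 = r / (2 * Num.sqrt k%:R) * (k%:R / 10).
  by rewrite [X in X / 10]kE; field; rewrite gt_eqF.
by rewrite ler_wpM2l ?divr_ge0 ?mulr_ge0//; lra.
Qed.

End risk.

Lemma expR_ln_bin_le (R : realType) (n : nat) (x : R) :
  (0 < n)%N -> 0 < x -> x <= n.+4%:R ->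
  expR (ln x / 8) <= 3 / 4 * n.+1%:R.
Proof.
move=> n0 x0 xn; set y : R := n.+1%:R.
have y2 : 2 <= y by rewrite ler_nat.
have {xn} xy : x <= y ^+ 4.
  apply: (le_trans xn); rewrite -(natr1 n.+3) -(natr1 n.+2) -(natr1 n.+1) -/y.
  have y4 : 4 <= y * y by nra.
  by rewrite (_ : y ^+ 4 = (y * y) * (y * y)); [nra|ring].
have e8 : expR (ln x / 8) ^+ 2 <= y.
  rewrite -expRM_natl.
  have y0 : 0 < y by lra.
  rewrite -[leRHS](lnK y0) ler_expR.
  have : ln x <= 4%:R * ln y.
    rewrite mulr_natl -lnXn// ler_ln// posrE//; exact: exprn_gt0.
  by lra.
rewrite -ler_sqr ?nnegrE ?expR_ge0//; last by lra.
by apply: (le_trans e8); nra.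
Qed.

Theorem theorem3p4 (R : realType) :
  exists c1 c2 : R, 0 < c1 /\ 0 < c2 /\
    forall k d : nat, (0 < k)%N -> (4 * k <= d)%N ->
      exists G : 'cV[R]_k.+1 -> 'cV[R]_d,
        is_relu_network3 G /\
        forall m : nat,
          c1 * k%:R * ln (d%:R / k%:R) <= m%:R ->
          ((c2 * Num.sqrt (k%:R * ln (d%:R / k%:R) / m%:R))%:E
             <= minimax_risk m (range G `&` unit_ball R d))%E.
Proof.
exists 1, (1 / 80); split => //; split; first by lra.
move=> k d k0 kd; pose n := (d %/ k - 3)%N.
have dk4 : (4 <= d %/ k)%N by rewrite leq_divRL.
have nE : n.+3 = (d %/ k)%N by rewrite /n -addn3 subnK// ltnW.
have n0 : (0 < n)%N by rewrite subn_gt0.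
have knd : (k * n.+3 <= d)%N by rewrite nE mulnC leq_trunc_div.
have cells_le : (#|{: 'I_k * 'I_n.+1}| <= d)%N.
  rewrite card_prod !card_ord (leq_trans _ knd)// leq_mul2l.
  by apply/orP; right; rewrite ltnW.
pose pos (i : 'I_k) (j : 'I_n.+1) := widen_ord cells_le (enum_rank (i, j)).
have pos_inj i j i' j' : pos i j = pos i' j' -> i = i' /\ j = j'.
  by move=> /(congr1 val)/= /val_inj/enum_rank_inj[-> ->].
exists (bin_network pos); split; first exact: is_relu_network3_bin_network.
move=> m; rewrite mul1r; set x : R := d%:R / k%:R; set L := ln x => km.
have kR : 1 <= k%:R :> R by rewrite ler1n.
have x4 : 4 <= x.
  by rewrite ler_pdivlMr ?ltr0n// -natrM ler_nat.
have xn : x <= n.+4%:R.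
  rewrite ler_pdivrMr ?ltr0n// -natrM ler_nat nE ltnW//.
  exact: ltn_ceil.
have L0 : 0 < L by apply: ln_gt0; lra.
have m0 : 0 < m%:R :> R by apply: lt_le_trans km; rewrite mulr_gt0// ltr0n.
pose r := Num.sqrt (L / m%:R) / 4.
have r0 : 0 <= r by rewrite divr_ge0.
have r2 : r ^+ 2 = L / (16 * m%:R).
  rewrite exprMn sqr_sqrtr ?divr_ge0 ?ltW//.
  by field; rewrite gt_eqF.
have kr2 : k%:R * r ^+ 2 <= 16^-1.
  by rewrite r2 mulrA ler_pdivrMr ?mulr_gt0//; lra.
have r24 : r ^+ 2 <= 4^-1 by have := sqr_ge0 r; nra.
apply: le_ereal_inf_tmp => _ [est mest <-].
have [|l] := exists_risk_bin_code_ge pos_inj k0 mest r0 r24.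
  rewrite -expRM_natl (_ : _ * _ = L / 8); last first.
    by rewrite r2; field; rewrite gt_eqF.
  by apply: expR_ln_bin_le => //; lra.
rewrite (_ : _ / 20 = 1 / 80 * Num.sqrt (k%:R * L / m%:R)); last first.
  by rewrite -[k%:R * L / _]mulrA sqrtrM// /r; field.
move=> /le_trans; apply; apply: ereal_sup_ubound; exists (bin_code pos r l) => //.
split; first by exists (code_input r l) => //; rewrite -code_in_range.
rewrite /unit_ball /= l2norm_bin_code// -[leRHS]sqrtr1.
rewrite -[r]ger0_norm// -sqrtr_sqr -sqrtrM ?sqr_ge0// ler_wsqrtr//.
by lra.
Qed.
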